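(* Let $n\geq 3$ be a natural number and let $R=\mathbb{R}[t^{\pm 1}]$. Then the representation $\rho:PS_n\to GL(V)$ described in the context (the Lawrence--Krammer representation specialized at $q=1$) is faithful. Consequently, $PS_n$ is a linear group.
   Context: For $n\geq 3$, the pseudosymmetric group $PS_n$ is the group with generators $\sigma_i$, $1\leq i\leq n-1$, and relations $\sigma_i\sigma_j=\sigma_j\sigma_i$ if $|i-j|\geq 2$, $\sigma_i\sigma_{i+1}\sigma_i=\sigma_{i+1}\sigma_i\sigma_{i+1}$ for $1\leq i\leq n-2$, and $\sigma_i\sigma_{i+1}^{-1}\sigma_i=\sigma_{i+1}\sigma_i^{-1}\sigma_{i+1}$ for $1\leq i\leq n-2$ (the last family may equivalently be replaced by $\sigma_i^2\sigma_{i+1}^2=\sigma_{i+1}^2\sigma_i^2$ for $1\leq i\leq n-2$). Let $R=\mathbb{R}[t^{\pm1}]$ be the ring of Laurent polynomials in $t$ with real coefficients and let $V$ be a free $R$-module of rank $n(n-1)/2$ with basis $\{x_{i,j}\}_{1\leq i<j\leq n}$. The representation $\rho:PS_n\to GL(V)$, written $\rho(x)(v)=xv$, is the group homomorphism determined on generators ($1\leq k\leq n-1$) by the $R$-linear maps $\sigma_kx_{k,k+1}=t\,x_{k,k+1}$; $\sigma_kx_{i,k}=x_{i,k+1}$ for $i<k$; $\sigma_kx_{i,k+1}=x_{i,k}$ for $i<k$; $\sigma_kx_{k,j}=x_{k+1,j}$ for $k+1<j$; $\sigma_kx_{k+1,j}=x_{k,j}$ for $k+1<j$; $\sigma_kx_{i,j}=x_{i,j}$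 for $i<j<k$ or $k+1<i<j$; $\sigma_kx_{i,j}=x_{i,j}$ for $i<k<k+1<j$. These formulas do define a representation of $PS_n$. A group is linear if it is isomorphic to a subgroup of $GL_m(K)$ for some field $K$ and some natural number $m$. *)

(* Defs.v *)
From HB Require Import structures.
From mathcomp Require Import all_boot all_order all_algebra.
From mathcomp Require Import boolp reals.
From mathcomp Require Import zify.
Set Implicit Arguments. Unset Strict Implicit. Unset Printing Implicit Defensive.
Import GRing.Theory.

Local Open Scope quotient_scope.
Local Open Scope group_scope.

Section Presentation.
Variable S : choiceType.

(* The letter (s, true) stands for s, the letter (s, false) for s^-1. *)
Definition word := seq (S * bool).

Implicit Types u v w : word.

Definition invw w : word := rev [seq (a.1, ~~ a.2) | a <- w].

(* The congruence on words generated by the free reductions and by the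
   relations rels. *)
Inductive cong (rels : word -> word -> Prop) : word -> word -> Prop :=
| cong_refl u : cong rels u u
| cong_sym u v : cong rels u v -> cong rels v u
| cong_trans u v w : cong rels u v -> cong rels v w -> cong rels u w
| cong_cat u u' v v' :
    cong rels u u' -> cong rels v v' -> cong rels (u ++ v) (u' ++ v')
| cong_reduce s b : cong rels [:: (s, b); (s, ~~ b)] [::]
| cong_rel u v : rels u v -> cong rels u v.

Variable rels : word -> word -> Prop.

Definition congb : rel word := fun u v => `[< cong rels u v >].

Lemma congb_refl : reflexive congb.
Proof. by move=> u; apply/asboolP; exact: cong_refl. Qed.

Lemma congb_sym : symmetric congb.
Proof. by move=> u v; apply/asboolP/asboolP; exact: cong_sym. Qed.

Lemma congb_trans : transitive congb.
Proof.
move=> v u w /asboolP uv /asboolP vw; apply/asboolP; exact: cong_trans uv vw.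
Qed.

Definition cong_equiv := EquivRel congb congb_refl congb_sym congb_trans.

Definition presented := {eq_quot cong_equiv}.

HB.instance Definition _ := EqQuotient.on presented.
HB.instance Definition _ := Choice.on presented.

Definition pclass (u : word) : presented := \pi_presented u.

Lemma pclassW u v : cong rels u v -> pclass u = pclass v.
Proof. by move=> uv; apply/eqmodP/asboolP. Qed.

Lemma pclass_cong u v : pclass u = pclass v -> cong rels u v.
Proof. by move=> /eqmodP/asboolP. Qed.

Lemma pclass_repr (x : presented) : pclass (repr x) = x.
Proof. exact: reprK. Qed.

Lemma cong_repr u : cong rels (repr (pclass u)) u.
Proof. by apply: pclass_cong; rewrite pclass_repr. Qed.

Lemma invw_cons a w : invw (a :: w) = invw w ++ [:: (a.1, ~~ a.2)].
Proof. by rewrite /invw /= rev_cons -cats1. Qed.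

Lemma cong_catVw w : cong rels (invw w ++ w) [::].
Proof.
elim: w => [|[s b] w IH]; first exact: cong_refl.
rewrite invw_cons /= -catA.
apply: cong_trans IH; apply: cong_cat; first exact: cong_refl.
apply: (@cong_cat _ [:: (s, ~~ b); (s, b)] [::] w w); last exact: cong_refl.
by have := cong_reduce rels s (~~ b); rewrite negbK.
Qed.

Lemma cong_catwV w : cong rels (w ++ invw w) [::].
Proof.
elim: w => [|[s b] w IH]; first exact: cong_refl.
rewrite invw_cons.
apply: cong_trans (cong_reduce rels s b).
rewrite -[_ ++ _]/([:: (s, b)] ++ (w ++ (invw w ++ [:: (s, ~~ b)]))).
rewrite -[X in cong _ _ X]/([:: (s, b)] ++ ([::] ++ [:: (s, ~~ b)])).
apply: cong_cat; first exact: cong_refl.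
by rewrite catA; apply: cong_cat; [exact: IH | exact: cong_refl].
Qed.

Definition pone : presented := pclass [::].
Definition pmul (x y : presented) : presented := pclass (repr x ++ repr y).
Definition pinv (x : presented) : presented := pclass (invw (repr x)).

Lemma pmulE u v : pmul (pclass u) (pclass v) = pclass (u ++ v).
Proof. by apply: pclassW; apply: cong_cat; exact: cong_repr. Qed.

Lemma pmulA : associative pmul.
Proof.
move=> x y z; rewrite -[x]pclass_repr -[y]pclass_repr -[z]pclass_repr.
by rewrite !pmulE catA.
Qed.

Lemma pmul1 : left_id pone pmul.
Proof. by move=> x; rewrite -[x]pclass_repr pmulE. Qed.

Lemma p1mul : right_id pone pmul.
Proof. by move=> x; rewrite -[x]pclass_repr pmulE cats0. Qed.

Lemma pmulV : left_inverse pone pinv pmul.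
Proof.
move=> x; rewrite -[x in pmul _ x]pclass_repr pmulE; apply: pclassW.
exact: cong_catVw.
Qed.

Lemma pVmul : right_inverse pone pinv pmul.
Proof.
move=> x; rewrite -[x in pmul x _]pclass_repr pmulE; apply: pclassW.
exact: cong_catwV.
Qed.

HB.instance Definition _ := isGroup.Build presented pmulA pmul1 p1mul pmulV pVmul.

Definition pgen (s : S) : presented := pclass [:: (s, true)].

Section UniversalProperty.
Variables (G : groupType) (f : S -> G).

Definition eval_letter (a : S * bool) : G := if a.2 then f a.1 else (f a.1)^-1.
Definition eval_word (w : word) : G := foldr (fun a g => eval_letter a * g) 1 w.

Lemma eval_word_cat u v : eval_word (u ++ v) = eval_word u * eval_word v.
Proof. by elim: u => [|a u IH] /=; rewrite ?mul1g // IH mulgA. Qed.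

Hypothesis f_rels : forall u v, rels u v -> eval_word u = eval_word v.

Lemma eval_word_cong u v : cong rels u v -> eval_word u = eval_word v.
Proof.
elim=> {u v} [//|//|u v w _ -> _ ->//|u u' v v' _ uu' _ vv'|s b|u v /f_rels//].
  by rewrite !eval_word_cat uu' vv'.
by case: b; rewrite /eval_word /eval_letter /= mulg1 ?mulgV ?mulVg.
Qed.

Definition presented_fun (x : presented) : G := eval_word (repr x).

Lemma presented_funE u : presented_fun (pclass u) = eval_word u.
Proof. by apply: eval_word_cong; exact: cong_repr. Qed.

Lemma presented_fun_morphism : monoid.monoid_morphism presented_fun.
Proof.
split=> [|x y]; first exact: (presented_funE [::]).
rewrite -[x]pclass_repr -[y]pclass_repr [_ * _]pmulE !presented_funE.
exact: eval_word_cat.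
Qed.

Definition presented_lift : UMagmaMorphism.type presented G :=
  HB.pack presented_fun
    (isUMagmaMorphism.Build presented G presented_fun presented_fun_morphism).

Lemma presented_liftE u : presented_lift (pclass u) = eval_word u.
Proof. exact: presented_funE. Qed.

Lemma presented_lift_gen s : presented_lift (pgen s) = f s.
Proof. by rewrite presented_liftE /eval_word /eval_letter /= mulg1. Qed.

End UniversalProperty.
End Presentation.

(* The index k : 'I_n.-1 is 0-based: it stands for the generator usually
   written sigma_(k+1). *)
Inductive PS_rel (n : nat) : word 'I_n.-1 -> word 'I_n.-1 -> Prop :=
| PS_far (i j : 'I_n.-1) : (i.+2 <= j)%N || (j.+2 <= i)%N ->
    PS_rel [:: (i, true); (j, true)] [:: (j, true); (i, true)]
| PS_braid (i j : 'I_n.-1) : j = i.+1 :> nat ->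
    PS_rel [:: (i, true); (j, true); (i, true)]
           [:: (j, true); (i, true); (j, true)]
| PS_pseudo (i j : 'I_n.-1) : j = i.+1 :> nat ->
    PS_rel [:: (i, true); (j, false); (i, true)]
           [:: (j, true); (i, false); (j, true)].

Definition PS (n : nat) : groupType := presented (@PS_rel n).

Definition PSgen (n : nat) (k : 'I_n.-1) : PS n := pgen (@PS_rel n) k.

Section GL.
Variables (L : pzRingType) (V : lmodType L).

(* GL_inv is determined by GL_fun (GL_eqP): a GL is a bijective linear map. *)
Record GL := MkGL {
  GL_fun :> V -> V;
  GL_inv : V -> V;
  GL_linear : linear GL_fun;
  GL_funK : cancel GL_fun GL_inv;
  GL_invK : cancel GL_inv GL_fun }.

HB.instance Definition _ := gen_eqMixin GL.
HB.instance Definition _ := gen_choiceMixin GL.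

Lemma GL_eqP (f g : GL) : f =1 g -> f = g.
Proof.
case: f g => [f f' fl fK f'K] [g g' gl gK g'K] /= fg.
have {}fg : f = g by apply: funext.
subst g.
have ? : f' = g' by apply: funext => v; rewrite -{1}[v]g'K fK.
by subst g'; congr MkGL; exact: Prop_irrelevance.
Qed.

Definition GL_one : GL :=
  @MkGL id id (fun _ _ _ => erefl) (fun _ => erefl) (fun _ => erefl).

Lemma GL_mul_linear (f g : GL) : linear (f \o g).
Proof. by move=> a u v /=; rewrite !GL_linear. Qed.

Definition GL_mul (f g : GL) : GL :=
  MkGL (@GL_mul_linear f g) (can_comp (GL_funK f) (GL_funK g))
       (can_comp (GL_invK g) (GL_invK f)).

Lemma GL_inv_linear (f : GL) : linear (GL_inv f).
Proof. by move=> a u v; apply: (can_inj (GL_funK f)); rewrite GL_linear !GL_invK. Qed.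

Definition GL_inverse (f : GL) : GL :=
  MkGL (@GL_inv_linear f) (GL_invK f) (GL_funK f).

Lemma GL_mulA : associative GL_mul. Proof. by move=> f g h; exact: GL_eqP. Qed.
Lemma GL_mul1 : left_id GL_one GL_mul. Proof. by move=> f; exact: GL_eqP. Qed.
Lemma GL_1mul : right_id GL_one GL_mul. Proof. by move=> f; exact: GL_eqP. Qed.
Lemma GL_mulV : left_inverse GL_one GL_inverse GL_mul.
Proof. by move=> f; apply: GL_eqP => v /=; rewrite GL_funK. Qed.
Lemma GL_Vmul : right_inverse GL_one GL_inverse GL_mul.
Proof. by move=> f; apply: GL_eqP => v /=; rewrite GL_invK. Qed.

HB.instance Definition _ := isGroup.Build GL GL_mulA GL_mul1 GL_1mul GL_mulV GL_Vmul.

End GL.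

Section GLmx.
Variables (K : fieldType) (m : nat).

Record GLmx := MkGLmx { GLmx_val :> 'M[K]_m; _ : GLmx_val \in unitmx }.

HB.instance Definition _ := [isSub for GLmx_val].
HB.instance Definition _ := [Choice of GLmx by <:].

Lemma GLmx_unit (A : GLmx) : (A : 'M_m) \in unitmx. Proof. exact: valP. Qed.

Definition GLmx_one : GLmx := MkGLmx (unitmx1 K m).

Lemma GLmx_mul_subproof (A B : GLmx) : (A *m B)%R \in unitmx.
Proof. by rewrite unitmx_mul !GLmx_unit. Qed.
Definition GLmx_mul (A B : GLmx) : GLmx := MkGLmx (GLmx_mul_subproof A B).

Lemma GLmx_inv_subproof (A : GLmx) : invmx A \in unitmx.
Proof. by rewrite unitmx_inv GLmx_unit. Qed.
Definition GLmx_inv (A : GLmx) : GLmx := MkGLmx (GLmx_inv_subproof A).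

Lemma GLmx_mulA : associative GLmx_mul.
Proof. by move=> A B C; apply: val_inj; exact: mulmxA. Qed.
Lemma GLmx_mul1 : left_id GLmx_one GLmx_mul.
Proof. by move=> A; apply: val_inj; exact: mul1mx. Qed.
Lemma GLmx_1mul : right_id GLmx_one GLmx_mul.
Proof. by move=> A; apply: val_inj; exact: mulmx1. Qed.
Lemma GLmx_mulV : left_inverse GLmx_one GLmx_inv GLmx_mul.
Proof. by move=> A; apply: val_inj; apply: mulVmx; exact: GLmx_unit. Qed.
Lemma GLmx_Vmul : right_inverse GLmx_one GLmx_inv GLmx_mul.
Proof. by move=> A; apply: val_inj; apply: mulmxV; exact: GLmx_unit. Qed.

HB.instance Definition _ :=
  isGroup.Build GLmx GLmx_mulA GLmx_mul1 GLmx_1mul GLmx_mulV GLmx_Vmul.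

End GLmx.

Definition linear_group (G : groupType) : Prop :=
  exists (K : fieldType) (m : nat) (H : {pred GLmx K m})
         (f : {multiplicative G -> GLmx K m}),
    [/\ group_closed H, injective f & forall A, A \in H <-> exists g, f g = A].

Section Laurent.
Local Open Scope ring_scope.
Variable F : fieldType.

(* F[t, t^-1] as the localization of F[t] at t, inside F(t). *)
Definition is_laurent : {pred {fraction {poly F}}} :=
  fun f => `[< exists (p : {poly F}) (k : nat),
                 f * FracField.tofrac 'X ^+ k = FracField.tofrac p >].

Lemma laurent_subring : subring_closed is_laurent.
Proof.
split.
- by apply/asboolP; exists 1, 0; rewrite expr0 mulr1 rmorph1.
- move=> f g /asboolP[p [k fp]] /asboolP[q [l gq]]; apply/asboolP.
  exists (p * 'X^l - q * 'X^k), (k + l)%N.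
  rewrite rmorphB !rmorphM !rmorphXn /= -fp -gq mulrBl exprD.
  by congr (_ - _); rewrite -!mulrA // [X in _ = _ * X]mulrC.
- move=> f g /asboolP[p [k fp]] /asboolP[q [l gq]]; apply/asboolP.
  exists (p * q), (k + l)%N.
  by rewrite rmorphM /= -fp -gq exprD mulrACA.
Qed.

HB.instance Definition _ := GRing.isSubringClosed.Build _ is_laurent laurent_subring.

Record laurent := MkLaurent
  { laurent_val :> {fraction {poly F}}; _ : laurent_val \in is_laurent }.

HB.instance Definition _ := [isSub for laurent_val].
HB.instance Definition _ := [Choice of laurent by <:].
HB.instance Definition _ := [SubChoice_isSubComNzRing of laurent by <:].

Lemma tofracX_neq0 : FracField.tofrac ('X : {poly F}) != 0.
Proof. by rewrite tofrac_eq0 polyX_eq0. Qed.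

Lemma is_laurentX : FracField.tofrac 'X \in is_laurent.
Proof. by apply/asboolP; exists 'X, 0; rewrite expr0 mulr1. Qed.

Lemma is_laurentXV : (FracField.tofrac 'X)^-1 \in is_laurent.
Proof. by apply/asboolP; exists 1, 1%N; rewrite rmorph1 mulVf ?tofracX_neq0. Qed.

Definition laurentX : laurent := MkLaurent is_laurentX.
Definition laurentXV : laurent := MkLaurent is_laurentXV.

Lemma laurentXK : laurentX * laurentXV = 1.
Proof. by apply: val_inj; rewrite /= mulfV ?tofracX_neq0. Qed.

End Laurent.

Section LawrenceKrammer.
Local Open Scope ring_scope.
Variables (L : comNzRingType) (n : nat).

(* All indices are 0-based: LKx i j with i < j < n is usually written
   x_(i+1, j+1). *)
Definition pairs := {p : 'I_n * 'I_n | (p.1 < p.2)%N}.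

Definition LKmod := {ffun pairs -> L^o}.

HB.instance Definition _ := GRing.Lmodule.on LKmod.

Definition LKx (i j : nat) : LKmod :=
  [ffun p : pairs => (((val p).1 == i :> nat) && ((val p).2 == j :> nat))%:R].

(* The image of the basis vector x_(i, j), i < j, under sigma_k when c = t,
   and under its inverse when c = t^-1. *)
Definition LK_basis (c : L) (k i j : nat) : LKmod :=
  if (i == k) && (j == k.+1) then c *: LKx k k.+1
  else if j == k then LKx i k.+1
  else if j == k.+1 then LKx i k
  else if i == k then LKx k.+1 j
  else if i == k.+1 then LKx k j
  else LKx i j.

Definition LK_map (c : L) (k : nat) (v : LKmod) : LKmod :=
  \sum_(p : pairs) (v p : L) *: LK_basis c k (val p).1 (val p).2.

Lemma LK_map_linear c k : linear (LK_map c k).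
Proof.
move=> a u v; rewrite /LK_map scaler_sumr -big_split /=; apply: eq_bigr => p _.
by rewrite !ffunE scalerDl scalerA.
Qed.

Lemma LKx_decomp (v : LKmod) :
  v = \sum_(p : pairs) (v p : L) *: LKx (val p).1 (val p).2.
Proof.
apply/ffunP => q; rewrite sum_ffunE (bigD1 q) //= big1 => [|p pq].
  by rewrite !ffunE !eqxx addr0; exact/esym/mulr1.
rewrite !ffunE (_ : _ && _ = false); first exact: mulr0.
apply: contra_neqF pq => /andP[/eqP pq1 /eqP pq2]; apply: val_inj.
rewrite [val p]surjective_pairing [val q]surjective_pairing.
by congr (_, _); apply: val_inj.
Qed.

Lemma LK_mapZ c k a v : LK_map c k (a *: v) = a *: LK_map c k v.
Proof.
rewrite /LK_map scaler_sumr; apply: eq_bigr => p _.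
by rewrite !ffunE scalerA.
Qed.

Lemma LK_mapE c k i j : (i < j < n)%N ->
  LK_map c k (LKx i j) = LK_basis c k i j.
Proof.
case/andP=> ij jn; pose p : pairs := exist _ (Ordinal (ltn_trans ij jn), Ordinal jn) ij.
rewrite /LK_map (bigD1 p) //= big1 => [|q qp].
  by rewrite !ffunE !eqxx addr0 scale1r.
rewrite !ffunE (_ : _ && _ = false) ?scale0r //.
apply: contra_neqF qp => /andP[/eqP qp1 /eqP qp2]; apply: val_inj => /=.
by rewrite [val q]surjective_pairing; congr (_, _); apply: val_inj.
Qed.

Lemma LK_ext (f g : LKmod -> LKmod) : linear f -> linear g ->
  (forall i j, (i < j < n)%N -> f (LKx i j) = g (LKx i j)) -> f =1 g.
Proof.
move=> lf lg fg v; pose F := GRing.isLinear.Build _ _ _ _ _ lf.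
pose f' : {linear LKmod -> LKmod} := HB.pack f F.
pose G := GRing.isLinear.Build _ _ _ _ _ lg.
pose g' : {linear LKmod -> LKmod} := HB.pack g G.
rewrite -[f]/(f' : _ -> _) -[g]/(g' : _ -> _) [v]LKx_decomp !linear_sum.
apply: eq_bigr => p _; rewrite !linearZ; congr (_ *: _); apply: fg.
by rewrite (valP p) ltn_ord.
Qed.

Ltac LK_step := rewrite ?LK_mapZ LK_mapE; [|lia]; rewrite /LK_basis;
  repeat (case: ifP => ?; try (exfalso; lia)).

Ltac LK_close := rewrite ?scalerA; repeat (congr (LKx _ _) || congr (_ *: _)); try lia.

Variables (t tV : L).
Hypothesis t_tV : t * tV = 1.

Lemma LK_mapK c d k : c * d = 1 -> (k.+1 < n)%N ->
  cancel (LK_map c k) (LK_map d k).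
Proof.
move=> cd kn; apply: (@LK_ext (LK_map d k \o LK_map c k) id) => //.
  by move=> a u v /=; rewrite !LK_map_linear.
move=> i j ij /=; repeat LK_step; rewrite ?scalerA ?cd ?scale1r; LK_close.
Qed.

Lemma tV_t : tV * t = 1. Proof. by rewrite mulrC. Qed.

Lemma LK_index (k : 'I_n.-1) : (k.+1 < n)%N.
Proof. by have := ltn_ord k; lia. Qed.

Definition LK_gen (k : 'I_n.-1) : GL LKmod :=
  MkGL (LK_map_linear t k) (LK_mapK t_tV (LK_index k)) (LK_mapK tV_t (LK_index k)).

Lemma LK_gen_linear c1 c2 c3 k1 k2 k3 :
  linear (fun v => LK_map c1 k1 (LK_map c2 k2 (LK_map c3 k3 v))).
Proof. by move=> a u v; rewrite !LK_map_linear. Qed.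

Lemma LK_far_rel c i j : (i.+2 <= j)%N -> (j.+1 < n)%N ->
  (fun v => LK_map c i (LK_map c j v)) =1 (fun v => LK_map c j (LK_map c i v)).
Proof.
move=> ij jn; apply: LK_ext => [a u v|a u v|r s rs]; rewrite ?LK_map_linear //.
move=> /=; repeat LK_step; LK_close.
Qed.

Lemma LK_braid_rel c d i : (i.+2 < n)%N ->
  (fun v => LK_map c i (LK_map d i.+1 (LK_map c i v))) =1
  (fun v => LK_map c i.+1 (LK_map d i (LK_map c i.+1 v))).
Proof.
move=> jn; apply: LK_ext => [||r s rs]; try exact: LK_gen_linear.
move=> /=; repeat LK_step; LK_close.
Qed.

Lemma LK_gen_rels (u v : word 'I_n.-1) : PS_rel u v ->
  eval_word LK_gen u = eval_word LK_gen v.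
Proof.
rewrite /eval_word /eval_letter.
case=> {u v} i j ij; rewrite /= !mulg1; apply: GL_eqP => w /=.
- case/orP: ij => ij; first exact: (LK_far_rel _ ij (LK_index j)).
  exact/esym/(LK_far_rel _ ij (LK_index i)).
- by rewrite ij; apply: LK_braid_rel; rewrite -ij LK_index.
- by rewrite ij; apply: LK_braid_rel; rewrite -ij LK_index.
Qed.

Definition LK_rep : UMagmaMorphism.type (PS n) (GL LKmod) :=
  presented_lift LK_gen_rels.

Lemma LK_repE (k : 'I_n.-1) : LK_rep (PSgen k) = LK_gen k.
Proof. exact: presented_lift_gen. Qed.

Lemma LK_rep_formulas (k : 'I_n.-1) (s := LK_rep (PSgen k)) :
  [/\ s (LKx k k.+1) = t *: LKx k k.+1,
      (forall i, (i < k)%N -> s (LKx i k) = LKx i k.+1 /\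
                              s (LKx i k.+1) = LKx i k),
      (forall j, (k.+1 < j < n)%N -> s (LKx k j) = LKx k.+1 j /\
                                     s (LKx k.+1 j) = LKx k j),
      (forall i j, (i < j < k)%N || (k.+1 < i < j)%N && (j < n)%N ->
                   s (LKx i j) = LKx i j) &
      (forall i j, (i < k)%N -> (k.+1 < j < n)%N -> s (LKx i j) = LKx i j)].
Proof.
rewrite {}/s LK_repE /=; have kn := LK_index k.
by split=> [|i ik|j kj|i j ij|i j ik kj]; try split; LK_step; LK_close.
Qed.

End LawrenceKrammer.

Definition LawrenceKrammer (R : realType) (n : nat) :
    UMagmaMorphism.type (PS n) (GL (LKmod (laurent R) n)) :=
  LK_rep n (laurentXK R).

(* Main.v *)
Require Import Defs.
From HB Require Import structures.
From mathcomp Require Import all_boot all_order all_algebra.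
From mathcomp Require Import boolp reals.
From mathcomp Require Import zify.
Set Implicit Arguments. Unset Strict Implicit. Unset Printing Implicit Defensive.
Import GRing.Theory.

(** Every sigma_k acts on the basis by the permutation of the pairs {i, j}
    induced by the transposition of k and k+1, up to a factor t on the pair
    {k, k+1} itself.  An element g of the kernel of the representation
    therefore induces the trivial permutation of the pairs, hence, as there
    are at least three points, of the points.  Three facts then finish the
    argument.

    - In the pseudosymmetric group the squares of neighbouring generators
      commute.  Consequently the pure braid generators a_(i,j), which are
      conjugates of the sigma_k^2, are permuted by conjugation: the conjugate
      of a_p by sigma_k is a_(s_k p), where s_k is the transposition
      ([band_conj]).  As a_q has trivial permutation, it commutes with every
      a_p ([band_commute]), and the a_p generate a normal abelian subgroup
      [pure].

    - Modulo [pure] the generators are involutions satisfying the braid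
      relations, so that the Coxeter presentation of the symmetric group
      ([coxeter_complete]) puts every element with trivial permutation in
      [pure] ([pure_kernel]).

    - The element a_q acts diagonally, by t^2 on x_q and trivially on the
      other basis vectors ([rho_band]).  Since the powers of t are distinct,
      the action of a product of elements a_p and of their inverses
      determines the exponents, so that only the trivial product acts
      trivially ([faithful_of_generators]).

    The argument works over every commutative ring containing an invertible t
    whose powers are distinct.  The field R(t) is such a ring as well, and
    writing the representation over it in matrices shows that the group is
    linear. *)

Local Open Scope group_scope.

(** * Coxeter presentation of the symmetric group *)

(* A test whose left side contains a conditional waits until that conditional
   has been resolved, so that the hypotheses produced are linear. *)
Ltac split_eqs := repeat match goal with
  | |- context [?x == ?y] =>
    lazymatch x with context [if _ then _ else _] => fail | _ => idtac end;
    case: (x =P y) => ? //=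
  end.

Definition adj_swap (k x : nat) : nat :=
  if x == k then k.+1 else if x == k.+1 then k else x.

Definition swaps (s : seq nat) (x : nat) : nat := foldr adj_swap x s.

(** Equality of words in the Coxeter group of type A_N, whose generators 0, ..,
    N-1 are the adjacent transpositions of the points 0, .., N. Only the
    defining relations bound the letters. *)
Inductive coxeter (N : nat) : seq nat -> seq nat -> Prop :=
| cox_refl s : coxeter N s s
| cox_sym s s' : coxeter N s s' -> coxeter N s' s
| cox_trans s s' s'' : coxeter N s s' -> coxeter N s' s'' -> coxeter N s s''
| cox_cat s s' u u' :
    coxeter N s s' -> coxeter N u u' -> coxeter N (s ++ u) (s' ++ u')
| cox_square k : k < N -> coxeter N [:: k; k] [::]
| cox_far i j : i.+1 < j -> j < N -> coxeter N [:: i; j] [:: j; i]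
| cox_braid i : i.+1 < N ->
    coxeter N [:: i; i.+1; i] [:: i.+1; i; i.+1].

Lemma cox_cons N k s s' : coxeter N s s' -> coxeter N (k :: s) (k :: s').
Proof. by move=> ss'; apply: (cox_cat (cox_refl N [:: k])). Qed.

Lemma cox_catr N s s' u : coxeter N s s' -> coxeter N (s ++ u) (s' ++ u).
Proof. by move=> ss'; apply: cox_cat => //; apply: cox_refl. Qed.

Lemma cox_catl N s s' u : coxeter N s s' -> coxeter N (u ++ s) (u ++ s').
Proof. by move=> ss'; apply: cox_cat => //; apply: cox_refl. Qed.

Lemma swaps_cat s s' x : swaps (s ++ s') x = swaps s (swaps s' x).
Proof. exact: foldr_cat. Qed.

Lemma swaps_coxeter N s s' : coxeter N s s' -> swaps s =1 swaps s'.
Proof.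
elim=> {s s'} [//|s s' _ ss' x|s s' s'' _ ss' _ ss'' x|s s' u u' _ ss' _ uu' x
  |k _ x|i j ij _ x|i _ x].
- by rewrite ss'.
- by rewrite ss' ss''.
- by rewrite !swaps_cat uu' ss'.
all: rewrite /swaps /= /adj_swap.
all: by split_eqs; lia.
Qed.

(** The word k+d-1, .., k+1, k. Read as a permutation it sends k to k + d; the
    words [descent k (m.+1 - k)], for k <= m.+1, represent the right
    cosets of <s_0, .., s_(m-1)> in <s_0, .., s_m>. *)
Fixpoint descent (k d : nat) : seq nat :=
  if d is d'.+1 then (k + d') :: descent k d' else [::].

Lemma descent_rcons k d : descent k d.+1 = descent k.+1 d ++ [:: k].
Proof.
elim: d => [|d IH]; first by rewrite /= addn0.
by rewrite [LHS]/= -/(descent k d.+1) IH /= addnS addSn.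
Qed.

Lemma cox_far_sym N i j : (i.+1 < j) || (j.+1 < i) -> i < N -> j < N ->
  coxeter N [:: i; j] [:: j; i].
Proof.
by case/orP=> ij iN jN; [apply: cox_far | apply/cox_sym/cox_far].
Qed.

Lemma cox_past_descent N k d j : j < N -> k + d <= N ->
  (j.+1 < k) || (k + d < j) ->
  coxeter N (descent k d ++ [:: j]) (j :: descent k d).
Proof.
move=> jN; elim: d => [|d IH] kd far; first exact: cox_refl.
rewrite /=; apply: cox_trans (cox_cons _ (IH _ _)) _; try lia.
by apply: (@cox_catr _ [:: k + d; j] [:: j; k + d]); apply: cox_far_sym; lia.
Qed.

(** When j meets the descent, the braid relation at j-1, j turns
    j (j-1) j into (j-1) j (j-1), and j-1 commutes with what stands on its
    left. *)
Lemma cox_through_descent N k d j : k < j < k + d -> k + d <= N ->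
  coxeter N (descent k d ++ [:: j]) (j.-1 :: descent k d).
Proof.
elim: d => [|d IH] kj kd; first by lia.
have [jd|jd] := ltnP j (k + d).
  rewrite /=; apply: cox_trans (cox_cons _ (IH _ _)) _; try lia.
  apply: (@cox_catr _ [:: k + d; j.-1] [:: j.-1; k + d]).
  by apply: cox_far_sym; lia.
have jE : j = k + d by lia.
case: d => [|d] in IH kj kd jd jE *; first by lia.
have -> : j.-1 = k + d by lia.
rewrite [descent _ _]/= -jE /=.
have {}jE : j = (k + d).+1 by lia.
apply: (@cox_trans _ _ ([:: j; k + d; j] ++ descent k d)).
  by do 2!apply: cox_cons; apply: cox_past_descent; lia.
apply: (@cox_catr _ _ [:: k + d; j; k + d]).
by rewrite jE; apply/cox_sym/cox_braid; lia.
Qed.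

(** Right multiplication by a letter j permutes the cosets of the descents:
    it lengthens the descent (j = k-1), shortens it (j = k), or moves to its
    left as a letter below m. *)
Lemma coset_descent N m s : m < N -> all (fun k => k <= m) s ->
  exists s' k, [/\ all (fun i => i < m) s', k <= m.+1 &
    coxeter N s (s' ++ descent k (m.+1 - k))].
Proof.
move=> mN; elim/last_ind: s => [|s j IH].
  by exists [::], m.+1; split; rewrite ?subnn //; apply: cox_refl.
rewrite all_rcons => /andP[jm /IH[s' [k [s'm km ss']]]].
have {}ss' : coxeter N (rcons s j) (s' ++ (descent k (m.+1 - k) ++ [:: j])).
  by rewrite -cats1 catA; apply: cox_catr.
have [jk|jk|jk] := ltngtP j k.
- have [jk1|jk1] := eqVneq j.+1 k.
    exists s', j; split; [done|lia|].
    by rewrite subSn // descent_rcons jk1 -subSS jk1.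
  exists (s' ++ [:: j]), k; split => //; first by rewrite all_cat s'm /=; lia.
  apply: cox_trans ss' _; rewrite -catA; apply: cox_catl.
  by apply: cox_past_descent; lia.
- exists (s' ++ [:: j.-1]), k; split => //; first by rewrite all_cat s'm /=; lia.
  apply: cox_trans ss' _; rewrite -catA; apply: cox_catl.
  by apply: cox_through_descent; lia.
- subst j; exists s', k.+1; split => //.
  apply: cox_trans ss' _; apply: cox_catl.
  rewrite subSn // descent_rcons subSS -catA.
  rewrite -[X in coxeter _ _ X]cats0; apply: cox_catl.
  by apply: cox_square; lia.
Qed.

Lemma swaps_fix m s x : all (fun i => i < m) s -> m < x -> swaps s x = x.
Proof.
move=> + mx; elim: s => [//|k s IH] /= /andP[km /IH ->].
by rewrite /adj_swap !gtn_eqF //; lia.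
Qed.

Lemma swaps_descent k d : swaps (descent k d) k = k + d.
Proof.
elim: d => [|d IH] /=; first by rewrite addn0.
by rewrite IH /adj_swap eqxx addnS.
Qed.

(** The Coxeter presentation of the symmetric group. A word over the letters
    up to m is a word over smaller letters, fixing the point m+1, followed by
    a descent from m to k, which sends k to m+1. If the permutation is
    trivial, then k = m+1, the descent is empty, and m decreases. *)
Theorem coxeter_complete N s : all (fun k => k < N) s ->
  (forall x, x <= N -> swaps s x = x) -> coxeter N s [::].
Proof.
suff H m : m <= N -> forall s, all (fun k => k < m) s ->
    (forall x, x <= N -> swaps s x = x) -> coxeter N s [::].
  by apply: H.
elim: m => [|m IH] mN {}s sm sid.
  by case: s sm {sid} => // *; apply: cox_refl.
have [s' [k [s'm km ss']]] := coset_descent mN sm.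
have kE : k = m.+1.
  apply/eqP; rewrite eqn_leq km /=.
  rewrite -[X in _ <= X]sid ?(leq_trans km) //.
  rewrite (swaps_coxeter ss') swaps_cat swaps_descent subnKC //.
  by rewrite (swaps_fix s'm).
rewrite kE subnn cats0 in ss'.
apply: (cox_trans ss'); apply: IH => [|//|x xN]; first exact: ltnW.
by rewrite -(swaps_coxeter ss') sid.
Qed.

(** * The abelian normal subgroup generated by the bands *)

(** The transposition of k and k+1 acting on the unordered pairs, each
    represented by its increasing enumeration. *)
Definition pair_swap (k : nat) (p : nat * nat) : nat * nat :=
  if (p.1 == k) && (p.2 == k.+1) then p else (adj_swap k p.1, adj_swap k p.2).

Definition valid_pair (N : nat) : pred (nat * nat) :=
  fun p => (p.1 < p.2 <= N)%N.

Lemma pair_swapK N k p : valid_pair N p -> pair_swap k (pair_swap k p) = p.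
Proof.
case: p => i j; rewrite /valid_pair /pair_swap /adj_swap /= => ij.
by split_eqs; congr (_, _); lia.
Qed.

Lemma pair_swap_valid N k p : (k < N)%N ->
  valid_pair N p -> valid_pair N (pair_swap k p).
Proof.
case: p => i j; rewrite /valid_pair /pair_swap /adj_swap => kN.
by rewrite /=; split_eqs; lia.
Qed.

Lemma commute_conj (G : groupType) (x y z : G) :
  commute x y -> commute x z -> commute x (y ^ z).
Proof.
by move=> xy xz; apply: commuteM; [apply: commuteV|apply: commuteM].
Qed.

Lemma conj_commute (G : groupType) (x z : G) : commute x z -> x ^ z = x.
Proof. by move=> xz; rewrite conjgE xz mulKg. Qed.

Lemma commute_conjr (G : groupType) (x y z : G) :
  commute x y -> commute (x ^ z) (y ^ z).
Proof. by rewrite /commute -!conjMg => ->. Qed.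

Section Bands.
Variables (G : groupType) (N : nat) (sg : nat -> G).
Hypothesis sg_far : forall i j, (i.+1 < j)%N -> (j < N)%N ->
  commute (sg i) (sg j).
Hypothesis sg_braid : forall i, (i.+1 < N)%N ->
  sg i * sg i.+1 * sg i = sg i.+1 * sg i * sg i.+1.
Hypothesis sg_pseudo : forall i, (i.+1 < N)%N ->
  sg i * (sg i.+1)^-1 * sg i = sg i.+1 * (sg i)^-1 * sg i.+1.

Lemma sg_far_sym i j : (i.+1 < j)%N || (j.+1 < i)%N -> (i < N)%N -> (j < N)%N ->
  commute (sg i) (sg j).
Proof. by case/orP=> ij iN jN; [|apply: commute_sym]; apply: sg_far. Qed.

(** Write a, b for the two generators and evaluate (a b^-1 a)(bab) twice: using
    aba = bab inside it gives a^2 b^2, while turning it first into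
    (b a^-1 b)(aba) and then using bab = aba gives b^2 a^2. *)
Lemma sg_sq_comm i : (i.+1 < N)%N -> commute (sg i ^+ 2) (sg i.+1 ^+ 2).
Proof.
move=> iN; have br := sg_braid iN; have ps := sg_pseudo iN.
set a := sg i in br ps *; set b := sg i.+1 in br ps *.
rewrite /commute; have <- : (a / b * a) * (b * a * b) = a ^+ 2 * b ^+ 2.
  have -> : a / b * a * (b * a * b) = a / b * (a * b * a) * b by rewrite !mulgA.
  by rewrite br !expg2 !mulgA mulgVK.
rewrite ps -br.
have -> : b / a * b * (a * b * a) = b / a * (b * a * b) * a by rewrite !mulgA.
by rewrite -br !expg2 !mulgA mulgVK.
Qed.

Lemma sg_conj_braid i : (i.+1 < N)%N -> sg i ^ sg i.+1 = sg i.+1 ^ (sg i)^-1.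
Proof.
move=> iN; have br := sg_braid iN; rewrite !conjgE invgK.
apply: (mulgI (sg i.+1)); apply: (mulIg (sg i)).
by rewrite mulVKg !mulgA mulgVK br.
Qed.

(** Conjugating sigma_(i+1)^2 by sigma_i or by its inverse gives the same
    result because sigma_i^2 commutes with sigma_(i+1)^2; this makes the
    two neighbours play symmetric roles. *)
Lemma sg_sq_conj i (iN : (i.+1 < N)%N) :
  (sg i ^+ 2) ^ sg i.+1 = (sg i.+1 ^+ 2) ^ sg i.
Proof.
rewrite conjXg sg_conj_braid // -conjXg.
apply: (canLR (conjgKV _)); rewrite -conjgM conj_commute //.
by rewrite invgK; apply: commute_sym; exact: (sg_sq_comm iN).
Qed.

(** The band a_(i,i+d+1) is sigma_i^2 conjugated by sigma_(i+1), ..,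
    sigma_(i+d): the pure braid generator of the strands i and i+d+1. *)
Fixpoint band_gap (i d : nat) : G :=
  if d is d'.+1 then band_gap i d' ^ sg (i + d)%N else sg i ^+ 2.

Definition band (p : nat * nat) : G := band_gap p.1 (p.2 - p.1.+1).

Lemma bandS i j : (i < j)%N -> band (i, j.+1) = band (i, j) ^ sg j.
Proof.
move=> ij; rewrite /band /= subSn //=; congr (_ ^ sg _); lia.
Qed.

Lemma band_base i : band (i, i.+1) = sg i ^+ 2.
Proof. by rewrite /band /= subnn. Qed.

Lemma band_ind i (P : nat -> Prop) :
  P i.+1 -> (forall j, (i < j)%N -> P j -> P j.+1) -> forall j, (i < j)%N -> P j.
Proof.
move=> P0 PS; elim=> [//|j IH]; rewrite ltnS leq_eqVlt => /predU1P[<-//|ij].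
by apply: PS => //; apply: IH.
Qed.

Lemma sg_band_outside k i j : (i < j <= N)%N -> (k < N)%N ->
  (k.+1 < i)%N || (j < k)%N -> commute (sg k) (band (i, j)).
Proof.
case/andP=> + + kN; move: j; apply: band_ind => [|j ij IH] jN far.
  by rewrite band_base; apply: commuteX; apply: sg_far_sym; lia.
rewrite bandS //; apply: commute_conj; first by apply: IH; lia.
by apply: sg_far_sym; lia.
Qed.

(** By induction on j: conjugating by sigma_j turns the claim for j+1 into the
    commutation of the band (i, j) with sigma_j^2 conjugated by sigma_(j+1),
    and the band (i, j) commutes with sigma_(j+1) as well. *)
Lemma sg_sq_band_top i j : (i < j < N)%N -> commute (sg j ^+ 2) (band (i, j)).
Proof.
case/andP; move: j; apply: band_ind => [|j ij IH] jN.
  by rewrite band_base; apply/commute_sym/sg_sq_comm.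
rewrite bandS // -[sg j.+1 ^+ 2](conjgKV (sg j)).
apply: commute_conjr.
have -> : (sg j.+1 ^+ 2) ^ (sg j)^-1 = (sg j ^+ 2) ^ sg j.+1.
  by rewrite conjXg -sg_conj_braid // -conjXg.
apply: commute_sym; apply: commute_conj.
  by apply: commute_sym; apply: IH; lia.
by apply: commute_sym; apply: sg_band_outside; lia.
Qed.

Lemma sg_band_bottom i j : (i.+1 < j <= N)%N ->
  band (i.+1, j) ^ sg i = band (i, j).
Proof.
case/andP; move: j; apply: band_ind => [|j ij IH] jN.
  by rewrite (@bandS i) // !band_base sg_sq_conj.
rewrite !bandS ?(ltnW ij) // -IH ?(ltnW jN) //.
by rewrite -!conjgM (_ : commute (sg j) (sg i)) //; apply: sg_far_sym; lia.
Qed.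

Lemma sg_sq_band_bottom i j : (i.+1 < j <= N)%N ->
  commute (sg i ^+ 2) (band (i.+1, j)).
Proof.
case/andP; move: j; apply: band_ind => [|j ij IH] jN.
  by rewrite band_base; apply: sg_sq_comm.
rewrite bandS //; apply: commute_conj; first by apply: IH; lia.
by apply: commute_sym; apply: commuteX; apply: sg_far_sym; lia.
Qed.

(** The band (i, k+2) is the band (i, k) conjugated by sigma_k sigma_(k+1), and
    the braid relation says that sigma_k is sigma_(k+1) conjugated by the same
    element; the band (i, k) does not involve the strands of sigma_(k+1). *)
Lemma sg_band_inside k i j : (i < k)%N -> (k.+1 < j <= N)%N ->
  commute (sg k) (band (i, j)).
Proof.
move=> ik /andP[]; move: j; apply: band_ind => [|j kj IH] jN; last first.
  rewrite bandS; last by lia.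
  apply: commute_conj; first by apply: IH; lia.
  by apply: sg_far_sym; lia.
rewrite !bandS; try lia.
rewrite -conjgM -[X in commute X _](conjgKV (sg k * sg k.+1)).
apply: commute_conjr.
have -> : sg k ^ (sg k * sg k.+1)^-1 = sg k.+1.
  apply: (canLR (conjgK _)).
  by rewrite conjgE [X in _ * X]mulgA -sg_braid // mulKg.
by apply: sg_band_outside; lia.
Qed.

(** The key relation. If the transposition enlarges the gap of the pair, this
    is the definition at the upper end and [sg_band_bottom] at the lower one.
    If it reduces the gap, the same formula holds backwards, because sigma_k^2
    commutes with the band. If it fixes the pair, then sigma_k commutes with
    the band. *)
Lemma band_conj k p : (k < N)%N -> valid_pair N p ->
  band p ^ sg k = band (pair_swap k p).
Proof.
case: p => i j kN; rewrite /valid_pair /= => /andP[ij jN].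
have sqV (x y z : G) : commute (z ^+ 2) y -> x = y ^ z -> x ^ z = y.
  by move=> yz ->; rewrite -conjgM conj_commute //; apply: commute_sym.
rewrite /pair_swap /adj_swap /=.
have [ik|ik] := eqVneq i k; first subst i.
  have [->|jk] /= := eqVneq j k.+1.
    by rewrite band_base conj_commute //; apply/commute_sym/commuteX.
  rewrite ifF; last by lia.
  by apply: sqV; [apply: sg_sq_band_bottom|rewrite sg_band_bottom //]; lia.
have [ik1|ik1] /= := eqVneq i k.+1.
  by subst i; rewrite !ifF; [apply: sg_band_bottom|..]; lia.
have [jk|jk] := eqVneq j k; first by subst k; rewrite bandS.
have [jk1|jk1] := eqVneq j k.+1.
  by subst j; apply: sqV; [apply: sg_sq_band_top|rewrite bandS //]; lia.
apply: conj_commute; apply: commute_sym.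
have [lki|] := ltnP k i; first by apply: sg_band_outside; lia.
have [lkj|] := ltnP j k; first by move=> ?; apply: sg_band_outside; lia.
by move=> *; apply: sg_band_inside; lia.
Qed.

Lemma band_conjV k p : (k < N)%N -> valid_pair N p ->
  band p ^ (sg k)^-1 = band (pair_swap k p).
Proof.
move=> kN pN; apply: (canLR (conjgK _)).
by rewrite band_conj ?(@pair_swapK N) //; apply: pair_swap_valid.
Qed.

(** A band is a conjugate of some sigma_k^2, and sigma_k^2 acts on the bands
    by the square of a transposition. *)
Lemma band_commute p q : valid_pair N p -> valid_pair N q ->
  commute (band p) (band q).
Proof.
case: q => i j pN /andP[/= ij jN]; move: j ij jN p pN.
apply: band_ind => [|j ij IH] jN p pN.
  rewrite band_base expg2; apply: (mulgI (sg i * sg i)^-1).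
  rewrite mulKg -[LHS]/(band p ^ _) conjgM !band_conj ?(@pair_swapK N) //.
  exact: pair_swap_valid.
rewrite bandS // -[band p](conjgKV (sg j)) band_conjV //.
by apply: commute_conjr; apply: IH; [lia|apply: pair_swap_valid].
Qed.

Definition bands (l : seq (nat * nat)) : G := \prod_(p <- l) band p.

Lemma bands_cons p l : bands (p :: l) = band p * bands l.
Proof. exact: big_cons. Qed.

Lemma bands_cat l l' : bands (l ++ l') = bands l * bands l'.
Proof. exact: big_cat. Qed.

Lemma bands_commute l l' : all (valid_pair N) l -> all (valid_pair N) l' ->
  commute (bands l) (bands l').
Proof.
move=> /allP lN /allP l'N; rewrite /bands big_seq.
apply: commute_sym; apply: commute_prod => p /lN pN.
rewrite big_seq; apply: commute_sym; apply: commute_prod => q /l'N qN.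
exact: band_commute.
Qed.

Lemma bands_perm l l' : all (valid_pair N) l ->
  perm_eq l l' -> bands l = bands l'.
Proof.
elim: l l' => [|p l IH] l'.
  by move=> _; rewrite perm_sym => /perm_nilP ->.
move=> /= /andP[pN lN] pll'.
have pl' : p \in l' by rewrite -(perm_mem pll') mem_head.
case/splitPr: pl' pll' => l1 l2; rewrite perm_sym perm_catC /= perm_cons perm_sym.
move=> ll'; rewrite bands_cons (IH _ lN ll') !bands_cat bands_cons.
have /andP[l1N l2N] : all (valid_pair N) l2 && all (valid_pair N) l1.
  by rewrite -all_cat -(perm_all _ ll').
have bp : bands [:: p] = band p by rewrite /bands big_seq1.
rewrite (bands_commute l1N l2N) mulgA -bp (bands_commute (l' := l1)) ?/= ?pN //.
by rewrite -mulgA (bands_commute (l' := l2)) ?all_cat /= ?pN // mulgA.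
Qed.

(** The subgroup generated by the bands. As they commute, its elements are
    fractions of products of bands, and multisets of pairs can replace
    integer exponents. *)
Definition pure (g : G) := exists l l',
  [/\ all (valid_pair N) l, all (valid_pair N) l' & g = bands l / bands l'].

Lemma pure1 : pure 1.
Proof. by exists [::], [::]; split => //; rewrite /bands big_nil divgg. Qed.

Lemma pureV g : pure g -> pure g^-1.
Proof. by case=> l [l' [? ? ->]]; exists l', l; rewrite invgF. Qed.

Lemma pureM g h : pure g -> pure h -> pure (g * h).
Proof.
case=> l [l' [lN l'N ->]] [m [m' [mN m'N ->]]].
exists (l ++ m), (m' ++ l'); rewrite !all_cat lN mN m'N l'N; split => //.
rewrite !bands_cat invgM !mulgA; congr (_ * _); rewrite -!mulgA; congr (_ * _).
by apply: commute_sym; apply: commuteV; apply: bands_commute.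
Qed.

Lemma bands_conj (x : G) (f : nat * nat -> nat * nat) l :
  (forall p, valid_pair N p -> band p ^ x = band (f p)) ->
  all (valid_pair N) l -> bands l ^ x = bands (map f l).
Proof.
move=> fE; elim: l => [|p l IH] /=; first by rewrite /bands !big_nil conj1g.
by case/andP=> pN lN; rewrite !bands_cons conjMg IH // fE.
Qed.

Lemma pure_conj k (b : bool) g : (k < N)%N -> pure g ->
  pure (g ^ (if b then sg k else (sg k)^-1)).
Proof.
move=> kN [l [l' [lN l'N ->]]].
have swN m : all (valid_pair N) m -> all (valid_pair N) (map (pair_swap k) m).
  move=> /allP mN; rewrite all_map; apply/allP => p /mN /=.
  exact: pair_swap_valid.
exists (map (pair_swap k) l), (map (pair_swap k) l').
split; [exact: swN..|].
rewrite conjMg conjVg.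
by rewrite !(@bands_conj _ (pair_swap k)) // => p pN; case: b;
  rewrite ?band_conj ?band_conjV.
Qed.

Definition braid_prod (s : seq nat) : G := \prod_(k <- s) sg k.

Lemma braid_prod_cat s s' : braid_prod (s ++ s') = braid_prod s * braid_prod s'.
Proof. exact: big_cat. Qed.

Lemma pure_sq k : (k < N)%N -> pure (sg k ^+ 2).
Proof.
move=> kN; exists [:: (k, k.+1)], [::]; split => //.
  by rewrite /= /valid_pair /= ltnSn kN.
by rewrite /bands big_nil big_seq1 divg1 band_base.
Qed.

Lemma pure_conjs s g : all (fun k => k < N)%N s -> pure g ->
  pure (g ^ (braid_prod s)^-1).
Proof.
rewrite /braid_prod; elim: s g => [|k s IH] g /=.
  by rewrite big_nil invg1 conjg1.
case/andP=> kN sN gp; rewrite big_cons invgM conjgM.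
exact: (@pure_conj k false _ kN (IH _ sN gp)).
Qed.

(** The Coxeter relations hold modulo the normal subgroup [pure]. Equivalence
    of words preserves the bound on the letters, which is needed to conjugate
    by the prefix of a word. *)
Lemma pure_coxeter s s' : coxeter N s s' ->
  all (fun k => k < N)%N s = all (fun k => k < N)%N s' /\
  (all (fun k => k < N)%N s -> pure (braid_prod s / braid_prod s')).
Proof.
have braid_prod2 i j : braid_prod [:: i; j] = sg i * sg j.
  by rewrite /braid_prod !big_cons big_nil mulg1.
have braid_prod3 i j k : braid_prod [:: i; j; k] = sg i * sg j * sg k.
  by rewrite /braid_prod !big_cons big_nil mulg1 mulgA.
elim=> {s s'} [s|s s' _ [ss' IH]|s s' s'' _ [ss' IH] _ [ss'' IH']
  |s s' u u' _ [ss' IH] _ [uu' IH']|k kN|i j ij jN|i iN].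
- by split=> // _; rewrite divgg; apply: pure1.
- by split=> // /[!(esym ss')] /IH/pureV; rewrite invgF.
- split=> [|sN]; first by rewrite ss'.
  rewrite -(divgKA (braid_prod s')).
  by apply: pureM; [apply: IH|apply: IH'; rewrite -ss'].
- split=> [|]; first by rewrite !all_cat ss' uu'.
  rewrite all_cat => /andP[sN uN]; rewrite !braid_prod_cat invgM.
  have -> : braid_prod s * braid_prod u *
      ((braid_prod u')^-1 * (braid_prod s')^-1) =
    (braid_prod u / braid_prod u') ^ (braid_prod s)^-1 *
      (braid_prod s / braid_prod s').
    by rewrite conjgE invgK !mulgA mulgVK.
  by apply: pureM; [apply: pure_conjs => //; apply: IH'|apply: IH].
- split=> [|_]; first by rewrite /= kN.
  by rewrite braid_prod2 /braid_prod big_nil divg1; apply: pure_sq.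
- split=> [|_]; first by rewrite /= (ltn_trans _ jN) ?jN // ltnW.
  by rewrite !braid_prod2 sg_far // divgg; apply: pure1.
- split=> [|_]; first by rewrite /= iN (ltnW iN).
  by rewrite !braid_prod3 sg_braid // divgg; apply: pure1.
Qed.

(** Modulo the squares a generator equals its inverse. *)
Lemma pure_unsign (w : word nat) : all (fun k => k < N)%N (map fst w) ->
  pure (eval_word sg w / braid_prod (map fst w)).
Proof.
elim: w => [|[k b] w IH] /=.
  by rewrite /braid_prod big_nil divgg => _; apply: pure1.
case/andP=> kN /IH; rewrite /braid_prod big_cons invgM /eval_letter /=.
set x := eval_word sg w; set y := \prod_(_ <- _) _; move=> xy.
case: b.
  have -> : sg k * x * (y^-1 * (sg k)^-1) = (x / y) ^ (sg k)^-1.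
    by rewrite conjgE invgK !mulgA.
  exact: (@pure_conj k false).
have -> : (sg k)^-1 * x * (y^-1 * (sg k)^-1) = (x / y) ^ (sg k) * (sg k ^+ 2)^-1.
  by rewrite conjgE expg2 invgM !mulgA mulgK.
by apply: pureM; [apply: (@pure_conj k true)|apply/pureV/pure_sq].
Qed.

Lemma pure_kernel (w : word nat) : all (fun k => k < N)%N (map fst w) ->
  (forall x, (x <= N)%N -> swaps (map fst w) x = x) -> pure (eval_word sg w).
Proof.
move=> wN wid; have [_ /(_ wN)] := pure_coxeter (coxeter_complete wN wid).
rewrite {2}/braid_prod big_nil divg1 => sp.
rewrite -[eval_word _ _](mulgVK (braid_prod (map fst w))).
by apply: pureM => //; apply: pure_unsign.
Qed.

End Bands.

(** * Faithfulness over a ring with an element of infinite order *)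

Section Generators.
Variable n : nat.
Local Notation N := n.-1.

(** The value 1 out of range violates the braid relation at the boundary, which
    is why the relations below carry bounds. *)
Definition sigma (k : nat) : PS n := if insub k is Some i then PSgen i else 1.

Lemma sigmaE (i : 'I_N) : sigma i = PSgen i.
Proof. by rewrite /sigma valK. Qed.

Lemma sigma_ord k (kN : (k < N)%N) : sigma k = PSgen (Ordinal kN).
Proof. exact: (sigmaE (Ordinal kN)). Qed.

Lemma PSgenV (i : 'I_N) : (PSgen i)^-1 = pclass (@PS_rel n) [:: (i, false)].
Proof.
apply: (mulgI (PSgen i)); rewrite mulgV.
by rewrite [RHS]pmulE; apply: pclassW; apply: cong_sym;
  apply: (cong_reduce _ i true).
Qed.

Lemma eval_sigma (w : word 'I_N) :
  pclass (@PS_rel n) w = eval_word sigma [seq (val a.1, a.2) | a <- w].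
Proof.
elim: w => [//|[i b] w IH]; rewrite [eval_word _ _]/= -IH /eval_letter /= sigmaE.
rewrite -[_ :: w]/([:: (i, b)] ++ w) -[LHS]pmulE.
by case: b; rewrite ?PSgenV.
Qed.

Lemma sigma_far i j : (i.+1 < j)%N -> (j < N)%N -> commute (sigma i) (sigma j).
Proof.
move=> ij jN; have iN : (i < N)%N by lia.
rewrite !sigma_ord /commute [LHS]pmulE [RHS]pmulE.
by apply: pclassW; apply: cong_rel; apply: PS_far; rewrite ij.
Qed.

Lemma sigma_braid i : (i.+1 < N)%N ->
  sigma i * sigma i.+1 * sigma i = sigma i.+1 * sigma i * sigma i.+1.
Proof.
move=> jN; have iN : (i < N)%N by lia.
rewrite !sigma_ord ![PSgen _ * _]pmulE [LHS]pmulE [RHS]pmulE.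
by apply: pclassW; apply: cong_rel; apply: PS_braid.
Qed.

Lemma sigma_pseudo i : (i.+1 < N)%N ->
  sigma i * (sigma i.+1)^-1 * sigma i = sigma i.+1 * (sigma i)^-1 * sigma i.+1.
Proof.
move=> jN; have iN : (i < N)%N by lia.
rewrite !sigma_ord !PSgenV ![PSgen _ * _]pmulE [LHS]pmulE [RHS]pmulE.
by apply: pclassW; apply: cong_rel; apply: PS_pseudo.
Qed.

End Generators.

Lemma pair_swap_swaps s i j : let q := foldr pair_swap (i, j) s in
  q = (swaps s i, swaps s j) \/ q = (swaps s j, swaps s i).
Proof.
elim: s => [|k s] /=; first by left.
rewrite -/(swaps s i) -/(swaps s j).
move: (swaps s i) (swaps s j) => a b.
case=> ->; rewrite /pair_swap /adj_swap /=; split_eqs;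
  first [by left | by right | left; congr (_, _); lia | right; congr (_, _); lia].
Qed.

Section Faithful.
Local Open Scope ring_scope.
Variables (L : comNzRingType) (n : nat) (t tV : L) (t_tV : t * tV = 1).
Local Notation N := n.-1.
Variable rho : UMagmaMorphism.type (PS n) (GL (LKmod L n)).
Hypothesis rho_gen : forall k, rho (PSgen k) = LK_gen t_tV k.
Local Notation "x_[ p ]" := (LKx L n p.1 p.2) (format "x_[ p ]").

Lemma valid_pairE p : valid_pair N p -> (p.1 < p.2 < n)%N.
Proof. by rewrite /valid_pair; lia. Qed.

(** The coefficient of sigma_k (c = t) or of its inverse (c = t^-1) on the
    basis vector of the pair p. *)
Definition twist (c : L) (k : nat) (p : nat * nat) : L :=
  if p == (k, k.+1) then c else 1.

Lemma twist_pair_swap c k p : valid_pair N p ->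
  twist c k (pair_swap k p) = twist c k p.
Proof.
case: p => i j; rewrite /valid_pair /twist /pair_swap /adj_swap /= => ij.
by rewrite -[_ == _]/(andb _ _) [in RHS]xpair_eqE; split_eqs; lia.
Qed.

Lemma LK_map_pair c k p : valid_pair N p ->
  LK_map c k x_[p] = twist c k p *: x_[pair_swap k p].
Proof.
case: p => i j pN; rewrite LK_mapE ?valid_pairE //.
move: pN; rewrite /valid_pair /LK_basis /twist /pair_swap /adj_swap xpair_eqE /=.
by split_eqs => ij; subst; rewrite ?scale1r //; lia.
Qed.

Lemma GL_Z (f : GL (LKmod L n)) c v : f (c *: v) = c *: f v.
Proof.
have f0 : f 0 = 0.
  have := GL_linear f 1 0 0.
  by rewrite !scale1r addr0 -[LHS]addr0 => /addrI <-.
by have := GL_linear f c v 0; rewrite f0 !addr0.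
Qed.

Lemma rho_sigma k p : (k < N)%N -> valid_pair N p ->
  rho (sigma n k) x_[p] = twist t k p *: x_[pair_swap k p].
Proof. by move=> kN pN; rewrite sigma_ord rho_gen /= LK_map_pair. Qed.

Lemma rho_sigmaV k p : (k < N)%N -> valid_pair N p ->
  rho (sigma n k)^-1%g x_[p] = twist tV k p *: x_[pair_swap k p].
Proof. by move=> kN pN; rewrite gmulfV sigma_ord rho_gen /= LK_map_pair. Qed.

Lemma rho_word (w : word nat) p : all (fun k => k < N)%N (map fst w) ->
  valid_pair N p -> let q := foldr pair_swap p (map fst w) in
  valid_pair N q /\ exists c, rho (eval_word (sigma n) w) x_[p] = c *: x_[q].
Proof.
move=> + pN; elim: w => [_|[k b] w IH] /=.
  by split=> //; exists 1; rewrite scale1r gmulf1.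
case/andP=> kN /IH[qN [c cE]]; split; first exact: pair_swap_valid.
rewrite gmulfM /= cE /eval_letter /=; case: b.
  by eexists; rewrite GL_Z rho_sigma // scalerA.
by eexists; rewrite GL_Z rho_sigmaV // scalerA.
Qed.

(** By conjugation it is enough to look at sigma_k^2: both factors sigma_k
    contribute t on the pair k, k+1, and exchange two basis vectors or fix one
    elsewhere. *)
Lemma rho_band q p : valid_pair N q -> valid_pair N p ->
  rho (band (sigma n) q) x_[p] = (if p == q then t ^+ 2 else 1) *: x_[p].
Proof.
case: q => i j /andP[/= ij jN]; move: j ij jN p.
apply: band_ind => [|j ij IH] jN p pN.
  rewrite band_base expg2 gmulfM /= rho_sigma // GL_Z rho_sigma //; last first.
    exact: pair_swap_valid.
  rewrite (pair_swapK _ pN) scalerA twist_pair_swap // /twist.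
  by case: eqP; rewrite ?mulr1.
rewrite bandS // conjgE !gmulfM /= rho_sigma //.
have spN : valid_pair N (pair_swap j p) by apply: pair_swap_valid.
rewrite !GL_Z IH ?(ltnW jN) // GL_Z rho_sigmaV // (pair_swapK _ pN) !scalerA.
rewrite twist_pair_swap // mulrAC [twist t _ _ * _]mulrC.
have -> : twist tV j p * twist t j p = 1.
  by rewrite /twist; case: ifP; rewrite ?mulr1 // mulrC.
have -> : (pair_swap j p == (i, j)) = (p == (i, j.+1)).
  have sq : pair_swap j (i, j.+1) = (i, j).
    by rewrite /pair_swap /adj_swap /=; split_eqs; lia.
  rewrite -{1}sq; apply/eqP/eqP => [/(congr1 (pair_swap j))|-> //].
  by rewrite !(@pair_swapK N) //; rewrite /valid_pair /=; lia.
by rewrite mul1r.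
Qed.

Lemma rho_bands l p : all (valid_pair N) l -> valid_pair N p ->
  rho (bands (sigma n) l) x_[p] = t ^+ (2 * count_mem p l) *: x_[p].
Proof.
move=> + pN; elim: l => [_|q l IH] /=.
  by rewrite /bands big_nil gmulf1 scale1r.
case/andP=> qN lN; rewrite bands_cons gmulfM /= IH // GL_Z rho_band // scalerA.
congr (_ *: _); rewrite mulnDr exprD mulrC [q == p]eq_sym.
by case: eqP.
Qed.

Lemma LKx_coord p q (c d : L) : valid_pair N p -> c *: x_[q] = d *: x_[p] ->
  d != 0 -> p = q.
Proof.
move=> pN; have /andP[p12 p2n] := valid_pairE pN.
pose r : pairs n := exist _ (Ordinal (ltn_trans p12 p2n), Ordinal p2n) p12.
move=> /(congr1 (fun v : LKmod L n => v r)); rewrite !ffunE /= !eqxx /=.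
case: eqP => [p1|_]; last by rewrite [_ *: _]mulr0 [_ *: _]mulr1 => <-; rewrite eqxx.
case: eqP => [p2|_]; last by rewrite [_ *: _]mulr0 [_ *: _]mulr1 => <-; rewrite eqxx.
by move=> _ _; case: p q p1 p2 {pN p12 p2n r} => [? ?] [? ?] /= -> ->.
Qed.

Lemma LKx_scaleI p (c d : L) : valid_pair N p -> c *: x_[p] = d *: x_[p] -> c = d.
Proof.
move=> pN; have /andP[p12 p2n] := valid_pairE pN.
pose r : pairs n := exist _ (Ordinal (ltn_trans p12 p2n), Ordinal p2n) p12.
move=> /(congr1 (fun v : LKmod L n => v r)); rewrite !ffunE /= !eqxx /=.
by rewrite ![_ *: _]mulr1.
Qed.

(** An element of the kernel is a fraction of two products of bands; these act
    alike, and the eigenvalue t^(2e) on a basis vector recovers the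
    multiplicity e of the corresponding band in each of them. *)
Lemma faithful_of_generators : (3 <= n)%N -> injective (fun k => t ^+ k) ->
  injective rho.
Proof.
move=> n3 t_inj; apply: gmulf_inj => g; rewrite -[g]pclass_repr eval_sigma.
set w := map _ _ => rw1.
have wN : all (fun k => k < N)%N (map fst w).
  by rewrite -map_comp all_map; apply/allP => a _ /=.
pose f := swaps (map fst w).
have fixp i j : (i < j <= N)%N -> f i = i /\ f j = j \/ f i = j /\ f j = i.
  move=> ij; have pN : valid_pair N (i, j) by [].
  have [_ [c]] := rho_word wN pN; rewrite rw1 /= -[LHS]scale1r.
  move=> /esym cE; have qE := @LKx_coord (i, j) _ c 1 pN cE (oner_neq0 _).
  have := pair_swap_swaps (map fst w) i j; rewrite -qE /= -/f.
  by case=> -[<- <-]; auto.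
have := pure_kernel (@sigma_far n) (@sigma_braid n) (@sigma_pseudo n) wN.
case=> [x xN|l [l' [lN l'N gE]]].
  (* The value of f at a point lies in every pair containing that point, and
     two such pairs meet only there. *)
  have f01 := fixp 0%N 1%N ltac:(lia); have f02 := fixp 0%N 2%N ltac:(lia).
  have f12 := fixp 1%N 2%N ltac:(lia); rewrite -/(f x).
  have [x2|x2] := leqP x 2; last by have := fixp 0%N x ltac:(lia); lia.
  by case: x x2 xN => [|[|[|//]]] _ _; lia.
have ll' : perm_eq l l'.
  apply/allP => p; rewrite mem_cat => pl /=.
  have pN : valid_pair N p by case/orP: pl => [/(allP lN)|/(allP l'N)].
  have : rho (bands (sigma n) l) x_[p] = rho (bands (sigma n) l') x_[p].
    congr (GL_fun _ _); apply: (@divg1_eq _ _ _).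
    by rewrite -gmulfF -gE.
  rewrite !rho_bands // => /(LKx_scaleI pN)/t_inj /eqP.
  by rewrite eqn_pmul2l.
have := bands_perm (@sigma_far n) (@sigma_braid n) (@sigma_pseudo n) lN ll'.
by rewrite gE => ->; rewrite divgg.
Qed.

End Faithful.

Theorem LK_rep_faithful (L : comNzRingType) (n : nat) (t tV : L)
    (t_tV : (t * tV = 1)%R) :
  (3 <= n)%N -> injective (fun k => t ^+ k)%R -> injective (LK_rep n t_tV).
Proof. exact: (faithful_of_generators (@LK_repE L n t tV t_tV)). Qed.

(** * Matrices and linearity *)

Section GLMatrix.
Local Open Scope ring_scope.
Variables (K : fieldType) (n : nat).
Implicit Types f g : GL (LKmod K n).

Definition LKdelta (j : 'I_#|{: pairs n}|) : LKmod K n :=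
  LKx K n (val (enum_val j)).1 (val (enum_val j)).2.

Definition GL_mx f : 'M[K]_#|{: pairs n}| :=
  \matrix_(i, j) f (LKdelta j) (enum_val i).

Lemma GL_sum (I : finType) (F : I -> LKmod K n) f :
  f (\sum_i F i) = \sum_i f (F i).
Proof.
have f0 : f 0 = 0 by rewrite -[X in f X](scale0r 0) GL_Z scale0r.
have fD : {morph f : u v / u + v}.
  by move=> u v; have := GL_linear f 1 u v; rewrite !scale1r.
exact: (big_morph f fD f0).
Qed.

Lemma GL_mxM f g : GL_mx (f * g)%g = GL_mx f *m GL_mx g.
Proof.
apply/matrixP => i j; rewrite !mxE /= [X in f X]LKx_decomp GL_sum sum_ffunE.
rewrite (reindex (@enum_val _ {: pairs n})); last exact/onW_bij/enum_val_bij.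
by apply: eq_bigr => k _; rewrite !mxE GL_Z ffunE [LHS]mulrC.
Qed.

Lemma GL_mx1 : GL_mx 1%g = 1%:M.
Proof.
apply/matrixP => i j; rewrite !mxE /= ffunE -(inj_eq enum_val_inj) -val_eqE.
by rewrite -pair_eqE.
Qed.

Lemma GL_mx_unit f : GL_mx f \in unitmx.
Proof.
have /mulmx1_unit[] // : GL_mx f *m GL_mx f^-1%g = 1%:M.
by rewrite -GL_mxM mulgV GL_mx1.
Qed.

Definition GL_GLmx f : GLmx K #|{: pairs n}| := MkGLmx (GL_mx_unit f).

Lemma GL_GLmxM : {morph GL_GLmx : f g / (f * g)%g}.
Proof. by move=> f g; apply: val_inj; exact: GL_mxM. Qed.

HB.instance Definition _ := isMultiplicative.Build _ _ GL_GLmx GL_GLmxM.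

Lemma GL_GLmx_inj : injective GL_GLmx.
Proof.
move=> f g /(congr1 val)/matrixP fg; apply: GL_eqP => v.
rewrite [v]LKx_decomp !GL_sum; apply: eq_bigr => p _; rewrite !GL_Z.
congr (_ *: _); apply/ffunP => q.
by have := fg (enum_rank q) (enum_rank p); rewrite !mxE /LKdelta !enum_rankK.
Qed.

End GLMatrix.

Lemma linear_group_GL (K : fieldType) (n : nat) (G : groupType)
    (rho : UMagmaMorphism.type G (GL (LKmod K n))) :
  injective rho -> linear_group G.
Proof.
move=> rho_inj.
pose f : {multiplicative G -> GLmx K #|{: pairs n}|} := @GL_GLmx K n \o rho.
exists K, #|{: pairs n}|, (fun A => `[< exists g, f g = A >]), f; split.
- have fV g : f g^-1 = (f g)^-1.
    apply: (mulgI (f g)); rewrite -gmulfM !mulgV.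
    by apply: (mulgI (f 1)); rewrite -gmulfM !mulg1.
  split.
    by apply/asboolP; exists 1; apply: (mulgI (f 1)); rewrite -gmulfM !mulg1.
  move=> A B /asboolP[g <-] /asboolP[h <-]; apply/asboolP; exists (g / h).
  by rewrite gmulfM fV.
- by apply: inj_comp => //; apply: GL_GLmx_inj.
- by move=> A; split=> [/asboolP|?]; last exact/asboolP.
Qed.

Lemma tofracX_powI (F : fieldType) :
  injective (fun k => FracField.tofrac 'X ^+ k : {fraction {poly F}})%R.
Proof.
move=> k l /= /eqP; rewrite -!rmorphXn tofrac_eq.
move=> /eqP/(congr1 (fun p : {poly F} => size p)).
by rewrite /= !size_polyXn => -[].
Qed.

Theorem theorem4p1 (R : realType) (n : nat) (hn : (3 <= n)%N) :
  injective (LawrenceKrammer R n) /\ linear_group (PS n).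
Proof.
have XI := @tofracX_powI R; split.
  apply: LK_rep_faithful => // k l /(congr1 val); rewrite !rmorphXn.
  exact: XI.
apply: (linear_group_GL (rho := LK_rep n (mulfV (tofracX_neq0 R)))).
exact: LK_rep_faithful.
Qed.
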